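(* Given $n$ (the length of the codewords), let $m^*$ denote the maximum value of $m$ such that an equidistant code $E(n,d,m)$ exists for some $d$. If $n \equiv 3 \pmod 4$, then $m^* \le n+1$. If $n \not\equiv 3 \pmod 4$, then $m^* \le n$.
   Context: An equidistant code $E(n,d,m)$ consists of $m$ binary codewords of length $n$ (elements of $\{0,1\}^n$) such that the Hamming distance between any two distinct codewords is exactly $d$.
   Formalization: The second claim (m* ≤ n when n is not 3 mod 4) is stated only for n ≥ 2, since it is false for n = 1 (the words 0 and 1 give m* = 2) and for n = 0 (the empty word gives m* = 1). *)

(* Defs.v *)
From mathcomp Require Import all_boot.

Set Implicit Arguments.
Unset Strict Implicit.
Unset Printing Implicit Defensive.

Definition hamming_dist (n : nat) (x y : {ffun 'I_n -> bool}) : nat :=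
  #|[set i : 'I_n | x i != y i]|.

(* A code is a set of words: the [m] codewords of an E(n,d,m) are distinct. *)
Definition is_equidistant (n d m : nat) (C : {set {ffun 'I_n -> bool}}) : Prop :=
  #|C| = m /\
  forall x y, x \in C -> y \in C -> x <> y -> hamming_dist x y = d.

Definition equidistant_code_exists (n d m : nat) : Prop :=
  exists C : {set {ffun 'I_n -> bool}}, is_equidistant d m C.

Definition is_max_equidistant_size (n mstar : nat) : Prop :=
  (exists d, equidistant_code_exists n d mstar) /\
  (forall m, (exists d, equidistant_code_exists n d m) -> m <= mstar).

Lemma max_equidistant_size_exists (n : nat) :
  exists! mstar, is_max_equidistant_size n mstar.
Proof.
pose P m := [exists d : 'I_n.+1, exists C : {set {ffun 'I_n -> bool}},
  (#|C| == m) &&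
  [forall x in C, forall y in C, (x != y) ==> (hamming_dist x y == d)]].
have PE m : P m <-> exists d, equidistant_code_exists n d m.
  split.
    case/existsP=> d /existsP[C /andP[/eqP Cm /forall_inP dC]].
    exists d, C; split=> // x y xC yC /eqP xy.
    by move/forall_inP: (dC x xC) => /(_ y yC) /implyP /(_ xy) /eqP.
  case=> d [C [Cm dC]].
  have [le_dn|lt_nd] := leqP d n.
    apply/existsP; exists (Ordinal (le_dn : d < n.+1)); apply/existsP; exists C.
    rewrite Cm eqxx; apply/forall_inP=> x xC; apply/forall_inP=> y yC.
    by apply/implyP=> /eqP xy; apply/eqP/dC.
  apply/existsP; exists ord0; apply/existsP; exists C.
  rewrite Cm eqxx; apply/forall_inP=> x xC; apply/forall_inP=> y yC.
  apply/implyP=> /eqP xy; move: lt_nd; rewrite -(dC x y xC yC xy) ltnNge.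
  by rewrite -[n in _ <= n]card_ord max_card.
have P0 : exists m, P m.
  exists 0; apply/PE; exists 0, set0; split; first by rewrite cards0.
  by move=> x y; rewrite inE.
have Pb m : P m -> m <= #|{: {ffun 'I_n -> bool}}|.
  by case/PE=> d [C [<- _]]; apply: max_card.
case: (ex_maxnP P0 Pb) => M /PE PM Mmax; exists M; split.
  by split=> // m /PE; apply: Mmax.
move=> M' [PM' M'max]; apply/eqP; rewrite eqn_leq M'max //.
by apply: Mmax; apply/PE.
Qed.

(* Main.v *)
Require Import Defs.
From mathcomp Require Import all_boot.
From mathcomp Require Import all_order all_algebra.
From mathcomp Require Import zify ring.

(** Replace each bit [b] by the sign (-1)^b.  Two words at distance [d] become
    vectors with inner product n - 2d, so the Gram matrix of a code of size [m]
    with distance [d > 0] is 2d I + (n - 2d) J, with [J] the all-ones matrix.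
    Its eigenvalues are 2d and 2d + (n - 2d) m, the second one simple.  Since
    the vectors live in dimension [n], a code with [m > n] has a singular Gram
    matrix, and hence 2d m = n m + 2d ([gram_singular_eq]).

    This equation can be used twice.  If [m > n + 1], it also holds for the
    code with one word removed, and the two equations give 2d = n and then
    d = 0, which is absurd ([card_equidistant_leS]).  If [m = n + 1] with
    [n > 0], it says 2d = n + 1.  Any three words have pairwise distances with
    even sum ([hamming_dist_perimeter_even]), so [d] is even as soon as
    [m >= 3], and 4 divides n + 1. *)

Set Implicit Arguments.
Unset Strict Implicit.
Unset Printing Implicit Defensive.

Lemma hamming_distE (n : nat) (x y : {ffun 'I_n -> bool}) :
  hamming_dist x y = \sum_(i < n) (x i != y i).
Proof.
rewrite /hamming_dist cardsE -sum1_card big_mkcond.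
by apply: eq_bigr => i _; rewrite unfold_in; case: (_ != _).
Qed.

Lemma hamming_distxx (n : nat) (x : {ffun 'I_n -> bool}) : hamming_dist x x = 0.
Proof. by rewrite hamming_distE big1 // => i _; rewrite eqxx. Qed.

Lemma hamming_dist_gt0 (n : nat) (x y : {ffun 'I_n -> bool}) :
  x <> y -> 0 < hamming_dist x y.
Proof.
move=> neq_xy; rewrite lt0n; apply/eqP => /eqP; rewrite hamming_distE sum_nat_eq0.
move/forallP => eq_xy; apply: neq_xy; apply/ffunP => i.
by move: (eq_xy i); rewrite /= eqb0 negbK => /eqP.
Qed.

(** At every coordinate either zero or exactly two of the three pairs differ. *)
Lemma hamming_dist_perimeter_even (n : nat) (x y z : {ffun 'I_n -> bool}) :
  ~~ odd (hamming_dist x y + hamming_dist y z + hamming_dist x z).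
Proof.
rewrite !hamming_distE -!big_split /=.
elim/big_ind: _ => // [a b /negbTE a_even /negbTE b_even | i _].
  by rewrite oddD a_even b_even.
by case: (x i); case: (y i); case: (z i).
Qed.

Section SignVectors.

Import GRing.Theory Num.Theory.
Local Open Scope ring_scope.

Lemma sign_dot (n : nat) (x y : {ffun 'I_n -> bool}) :
  \sum_(i < n) (-1) ^+ x i * (-1) ^+ y i
    = n%:R - (2 * hamming_dist x y)%:R :> rat.
Proof.
rewrite hamming_distE natrM natr_sum mulr_sumr.
have -> : n%:R = \sum_(i < n) (1 : rat) by rewrite sumr_const card_ord.
rewrite -sumrB; apply: eq_bigr => i _.
by case: (x i); case: (y i).
Qed.

(** A linear dependency [u] between the sign vectors is killed by the Gram
    matrix: 2d u_k + (n - 2d) s = 0 for every [k], where [s] is the sum of the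
    u_i.  Adding these equations up gives s (2d + (n - 2d) m) = 0, and [s = 0]
    would force [u = 0]. *)
Lemma gram_singular_eq (n d : nat) (C : {set {ffun 'I_n -> bool}}) :
    is_equidistant d #|C| C -> (0 < d)%N -> (n < #|C|)%N ->
  (2 * d * #|C| = n * #|C| + 2 * d)%N.
Proof.
move=> [_ distC] d_gt0 lt_nC; set m := #|C| in lt_nC *.
pose w (i : 'I_m) : {ffun 'I_n -> bool} := enum_val i.
pose A : 'M[rat]_(m, n) := \matrix_(i, j) (-1) ^+ w i j.
have gramE i k : (A *m A^T) i k
    = n%:R - (2 * d)%:R + (2 * d)%:R * (i == k)%:R.
  rewrite mxE (eq_bigr (fun j => (-1) ^+ w i j * (-1) ^+ w k j)); last first.
    by move=> j _; rewrite !mxE.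
  rewrite sign_dot; have [->|neq_ik] := eqVneq i k.
    by rewrite hamming_distxx muln0 mulr1 subrK subr0.
  rewrite mulr0 addr0 distC //; try exact: enum_valP.
  by move=> /enum_val_inj /eqP; rewrite (negPf neq_ik).
have : kermx A != 0.
  rewrite -mxrank_eq0 mxrank_ker subn_eq0 -ltnNge.
  exact: leq_ltn_trans (rank_leq_col A) lt_nC.
case/rowV0Pn => u /sub_kermxP uA0 u_neq0.
pose s := \sum_i u 0 i.
have eq_u k : (n%:R - (2 * d)%:R) * s + (2 * d)%:R * u 0 k = 0.
  have : (u *m (A *m A^T)) 0 k = 0 by rewrite mulmxA uA0 mul0mx mxE.
  rewrite mxE => <-; rewrite /s mulr_sumr.
  rewrite [RHS](eq_bigr (fun i => (n%:R - (2 * d)%:R) * u 0 i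
      + (if i == k then (2 * d)%:R * u 0 i else 0))); last first.
    by move=> i _; rewrite gramE; case: (i == k) => /=; ring.
  by rewrite big_split -big_mkcond big_pred1_eq.
have d2_neq0 : (2 * d)%:R != 0 :> rat by rewrite pnatr_eq0; lia.
have s_neq0 : s != 0.
  apply: contraNneq u_neq0 => s0; apply/eqP/rowP => k; rewrite mxE.
  move: (eq_u k); rewrite s0 mulr0 add0r => /eqP.
  by rewrite mulf_eq0 (negPf d2_neq0) => /eqP.
have : \sum_k ((n%:R - (2 * d)%:R) * s + (2 * d)%:R * u 0 k) = 0.
  by rewrite big1 // => k _.
rewrite big_split -mulr_sumr -/s sumr_const card_ord /= => sum_eq.
have {sum_eq}: s * ((n * m + 2 * d)%:R - (2 * d * m)%:R) = 0.
  by rewrite -sum_eq -mulr_sumr -/s natrD !(natrM _ _ m); ring.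
by move/eqP; rewrite mulf_eq0 (negPf s_neq0) subr_eq0 eqr_nat => /eqP ->.
Qed.

End SignVectors.

Lemma equidistant_gt0 (n d m : nat) (C : {set {ffun 'I_n -> bool}}) :
  is_equidistant d m C -> 1 < m -> 0 < d.
Proof.
move=> [<- distC] /card_gt1P [x [y [xC yC /eqP neq_xy]]].
by rewrite -(distC x y xC yC neq_xy) hamming_dist_gt0.
Qed.

Lemma card_equidistant_leS (n d m : nat) (C : {set {ffun 'I_n -> bool}}) :
  is_equidistant d m C -> m <= n.+1.
Proof.
move=> equiC; have [cardC distC] := equiC; rewrite leqNgt; apply/negP => lt_n1m.
have d_gt0 : 0 < d by apply: (equidistant_gt0 equiC); lia.
have /card_gt0P [x xC] : 0 < #|C| by lia.
have cardCx := cardsD1 x C; rewrite xC in cardCx.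
have equiCx : is_equidistant d #|C :\ x| (C :\ x).
  by split=> // y z /setD1P [_ yC] /setD1P [_ zC]; apply: distC.
have eqC : 2 * d * #|C| = n * #|C| + 2 * d.
  by apply: gram_singular_eq; rewrite ?cardC //; lia.
have eqCx : 2 * d * #|C :\ x| = n * #|C :\ x| + 2 * d.
  by apply: gram_singular_eq => //; lia.
rewrite cardCx in eqC; have d2E : 2 * d = n by lia.
by rewrite d2E in eqCx; lia.
Qed.

Lemma equidistant_even (n d m : nat) (C : {set {ffun 'I_n -> bool}}) :
  is_equidistant d m C -> 2 < m -> ~~ odd d.
Proof.
move=> [<- distC] /card_gt2P [x [y [z [[xC yC zC]]]]].
case=> /eqP neq_xy /eqP neq_yz /eqP neq_zx.
have := hamming_dist_perimeter_even x y z.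
rewrite (distC x y) // (distC y z) // (distC x z) //; last exact/nesym.
by lia.
Qed.

Lemma equidistant_extremal_mod4 (n d : nat) (C : {set {ffun 'I_n -> bool}}) :
  is_equidistant d n.+1 C -> 1 < n -> n = 3 %[mod 4].
Proof.
move=> equiC n_gt1; have [cardC distC] := equiC.
have d_even : ~~ odd d by apply: (equidistant_even equiC).
have d_gt0 : 0 < d by apply: (equidistant_gt0 equiC); lia.
have eqC : 2 * d * #|C| = n * #|C| + 2 * d.
  by apply: gram_singular_eq; rewrite ?cardC.
have : n * (2 * d) = n * n.+1 by rewrite cardC in eqC; lia.
by move/eqP; rewrite eqn_pmul2l; lia.
Qed.

Theorem theorem1p1 (n mstar : nat)
    (hmstar : is_max_equidistant_size n mstar) :
  (n = 3 %[mod 4] -> mstar <= n.+1) /\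
  (n <> 3 %[mod 4] -> 2 <= n -> mstar <= n).
Proof.
case: hmstar => [[d [C equiC]] _].
have le_mS := card_equidistant_leS equiC; split=> // n_neq3 n_ge2.
move: le_mS; rewrite leq_eqVlt => /predU1P [mE | //].
by rewrite mE in equiC; case: n_neq3; apply: equidistant_extremal_mod4 equiC _.
Qed.
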